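(* Let $X=\{1,2,3,4,5,6\}$ be the quandle whose right multiplications $R_y:x\mapsto x*y$ are $$R_1=(3\;5)(4\;6),\quad R_2=(3\;6)(4\;5),\quad R_3=(1\;5)(2\;6),$$ $$R_4=(1\;6)(2\;5),\quad R_5=(1\;3)(2\;4),\quad R_6=(1\;4)(2\;3),$$ and let $X_1=\{1,2\}$, $X_2=\{3,4\}$, $X_3=\{5,6\}$, which are trivial subquandles of $X$. Then any ring automorphism $\psi$ of $\mathbb{Z}[X]$ can be presented in the form $\psi=\varphi_1\varphi_2\varphi_3\pi$, where $\varphi_i\in\mathrm{Aut}(\mathbb{Z}[X_i])$ for $i=1,2,3$ and $\pi$ is a permutation of the quandles $X_1,X_2,X_3$.
   Context: The integral quandle ring $\mathbb{Z}[X]$ is the free $\mathbb{Z}$-module with basis $\{e_x:x\in X\}$ and the bilinear (non-associative) product determined by $e_xe_y=e_{x*y}$, where $x*y=R_y(x)$. A trivial quandle is one with $x*y=x$ for all $x,y$. $\mathrm{Aut}(\mathbb{Z}[X_i])$ is the group of ring automorphisms of the quandle ring $\mathbb{Z}[X_i]$. As an additive group $\mathbb{Z}[X]=\mathbb{Z}[X_1]\oplus\mathbb{Z}[X_2]\oplus\mathbb{Z}[X_3]$; an element $\varphi_i\in\mathrm{Aut}(\mathbb{Z}[X_i])$ is regarded as the $\mathbb{Z}$-linear bijection of $\mathbb{Z}[X]$ that acts as $\varphi_i$ on $\mathbb{Z}[X_i]$ and as the identity on the other two summands. A permutation $\pi$ of the quandles $X_1,X_2,X_3$, given by $\sigma\in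 S_3$, is regarded as the $\mathbb{Z}$-linear bijection of $\mathbb{Z}[X]$ with $e_{2i-1}\mapsto e_{2\sigma(i)-1}$ and $e_{2i}\mapsto e_{2\sigma(i)}$ for $i=1,2,3$. The product $\varphi_1\varphi_2\varphi_3\pi$ is a composition of $\mathbb{Z}$-linear maps of $\mathbb{Z}[X]$ (the individual factors are not required to be ring automorphisms of $\mathbb{Z}[X]$). *)

(* Defs.v *)
From HB Require Import structures.
From mathcomp Require Import all_boot all_order all_algebra all_fingroup.
Set Implicit Arguments.
Unset Strict Implicit.
Unset Printing Implicit Defensive.
Import GRing.Theory.
Local Open Scope ring_scope.

Record finQuandle := FinQuandle {
  qsort :> finType;
  qop : qsort -> qsort -> qsort;
  qop_idem : forall x, qop x x = x;
  qop_bij : forall y, bijective (fun x => qop x y);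
  qop_dist : forall x y z, qop (qop x y) z = qop (qop x z) (qop y z) }.

Definition trivial_quandle (X : finQuandle) : Prop :=
  forall x y : X, qop x y = x.

(* In a finite quandle, closure under x * y already implies closure under the
   inverse right multiplications. *)
Definition subquandle_closed (X : finQuandle) (A : {set X}) : Prop :=
  forall x y, x \in A -> y \in A -> qop x y \in A.

Section Subquandle.
Variables (X : finQuandle) (A : {set X}) (hA : subquandle_closed A).

Let T : finType := {x : X | x \in A}.

Definition sub_qop (x y : T) : T :=
  exist _ (qop (val x) (val y)) (hA (valP x) (valP y)).

Lemma sub_qop_idem x : sub_qop x x = x.
Proof. by apply: val_inj; rewrite /= qop_idem. Qed.

Lemma sub_qop_bij y : bijective (fun x => sub_qop x y).
Proof.
apply: injF_bij => x1 x2 /(congr1 val) /= /(bij_inj (qop_bij (val y))).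
exact: val_inj.
Qed.

Lemma sub_qop_dist x y z :
  sub_qop (sub_qop x y) z = sub_qop (sub_qop x z) (sub_qop y z).
Proof. by apply: val_inj; rewrite /= qop_dist. Qed.

Definition subQuandle : finQuandle :=
  FinQuandle sub_qop_idem sub_qop_bij sub_qop_dist.

End Subquandle.

(* The element with coefficients u x on the basis (e_x) is the function u;
   the Z-module structure is that of the zmodType, with n u written u *~ n. *)
Notation qring X := {ffun qsort X -> int}.

Definition qbasis (X : finQuandle) (x : X) : qring X :=
  [ffun z => (z == x)%:R].

Definition qmul (X : finQuandle) (u v : qring X) : qring X :=
  \sum_(x : X) \sum_(y : X) qbasis (qop x y) *~ (u x * v y).

(* Quandle rings have no unit in general, so none is preserved. *)
Definition qring_aut (X : finQuandle) (f : qring X -> qring X) : Prop :=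
  [/\ bijective f,
      {morph f : u v / u + v} &
      {morph f : u v / @qmul X u v}].

Lemma qmul_basis (X : finQuandle) (x y : X) :
  qmul (qbasis x) (qbasis y) = qbasis (qop x y).
Proof.
rewrite /qmul (bigD1 x) //= (bigD1 y) //= !ffunE !eqxx mulr1 mulr1z.
rewrite big1 => [|j /negPf nj]; last by rewrite !ffunE nj mulr0 mulr0z.
rewrite addr0 big1 ?addr0 // => i /negPf ni.
by rewrite big1 // => j _; rewrite !ffunE ni mul0r mulr0z.
Qed.

Section Extension.
Variables (X : finQuandle) (A : {set X}) (hA : subquandle_closed A).
Let Y := subQuandle hA.

Definition qring_incl (w : qring Y) : qring X :=
  \sum_(a : Y) qbasis (sval a) *~ w a.

Definition qring_proj (u : qring X) : qring Y := [ffun a : Y => u (sval a)].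

(* f on the summand Z[A], the identity on the span of the e_x, x \notin A. *)
Definition qring_ext (f : qring Y -> qring Y) (u : qring X) : qring X :=
  qring_incl (f (qring_proj u)) + \sum_(x : X | x \notin A) qbasis x *~ u x.

End Extension.

(* The element k (1 <= k <= 6) of the quandle is the ordinal k - 1. *)
Definition pt (k : nat) : 'I_6 := inord k.-1.

Definition R6 (y : 'I_6) : {perm 'I_6} :=
  nth 1%g
    [:: tperm (pt 3) (pt 5) * tperm (pt 4) (pt 6);
        tperm (pt 3) (pt 6) * tperm (pt 4) (pt 5);
        tperm (pt 1) (pt 5) * tperm (pt 2) (pt 6);
        tperm (pt 1) (pt 6) * tperm (pt 2) (pt 5);
        tperm (pt 1) (pt 3) * tperm (pt 2) (pt 4);
        tperm (pt 1) (pt 4) * tperm (pt 2) (pt 3)]%g y.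

Definition op6 (x y : 'I_6) : 'I_6 := R6 y x.

Definition table6 : seq (seq nat) :=
  [:: [:: 0; 0; 4; 5; 2; 3];
      [:: 1; 1; 5; 4; 3; 2];
      [:: 4; 5; 2; 2; 0; 1];
      [:: 5; 4; 3; 3; 1; 0];
      [:: 2; 3; 0; 1; 4; 4];
      [:: 3; 2; 1; 0; 5; 5]]%N.

Lemma pt_val (k : nat) : (k.-1 < 6)%N -> pt k = k.-1 :> nat.
Proof. exact: inordK. Qed.

Lemma op6E (x y : 'I_6) : op6 x y = nth 0%N (nth [::] table6 x) y :> nat.
Proof.
rewrite /op6 /R6.
have E (z a b : 'I_6) : nat_of_ord (tperm a b z) =
  if z == a :> nat then b : nat else if z == b :> nat then a : nat else z.
  by rewrite permE /= -!val_eqE /=; case: ifP => // _; case: ifP.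
case: y => [[|[|[|[|[|[|y]]]]]] hy] //; rewrite /= permM !E !pt_val //=;
  by case: x => [[|[|[|[|[|[|x]]]]]] hx].
Qed.

Lemma op6_idem x : op6 x x = x.
Proof.
by apply: val_inj; rewrite /= op6E; case: x => [[|[|[|[|[|[|x]]]]]] hx].
Qed.

Lemma op6_bij y : bijective (fun x => op6 x y).
Proof. by apply: injF_bij => x1 x2 /perm_inj. Qed.

Lemma op6_dist x y z : op6 (op6 x y) z = op6 (op6 x z) (op6 y z).
Proof.
apply: val_inj; rewrite /= !op6E.
case: x => [[|[|[|[|[|[|x]]]]]] hx] //; case: y => [[|[|[|[|[|[|y]]]]]] hy] //;
by case: z => [[|[|[|[|[|[|z]]]]]] hz].
Qed.

Definition X6 : finQuandle := FinQuandle op6_idem op6_bij op6_dist.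

(* For i = 0, 1, 2, the subquandle X_(i+1) consists of 2 (i + 1) - 1 = lo i
   and 2 (i + 1) = hi i. *)
Definition lo (i : 'I_3) : X6 := pt (2 * i + 1).
Definition hi (i : 'I_3) : X6 := pt (2 * i + 2).

Definition block (i : 'I_3) : {set X6} := [set lo i; hi i].

Lemma block_op i x y : x \in block i -> y \in block i -> op6 x y = x.
Proof.
rewrite !inE => hx hy; apply: val_inj; rewrite /= op6E.
by case: i hx hy => [[|[|[|i]]] lti] // /orP[] /eqP-> /orP[] /eqP->;
  rewrite /lo /hi /= !pt_val.
Qed.

Lemma block_closed i : subquandle_closed (block i).
Proof. by move=> x y hx hy; rewrite /= (block_op hx hy). Qed.

Definition X6_ (i : 'I_3) : finQuandle := subQuandle (@block_closed i).

Lemma X6_trivial i : trivial_quandle (X6_ i).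
Proof. by move=> x y; apply: val_inj; exact: block_op (valP x) (valP y). Qed.

Definition block_perm (s : 'S_3) (u : qring X6) : qring X6 :=
  \sum_(i < 3) (qbasis (lo (s i)) *~ u (lo i) + qbasis (hi (s i)) *~ u (hi i)).

(* Main.v *)
From HB Require Import structures.
Require Import Defs.
From mathcomp Require Import all_boot all_order all_algebra all_fingroup.
From mathcomp Require Import zify ring.
Set Implicit Arguments.
Unset Strict Implicit.
Unset Printing Implicit Defensive.
Import GRing.Theory.
Local Open Scope ring_scope.

(** Number the blocks [X_1, X_2, X_3] by Z/3, and label the two elements of
    each block by Z/2. The quandle law then reads
    [(i, a) * (j, b) = (-(i + j), a + b)] for [i <> j], where [-(i + j)] is the
    third block, and [(i, a) * (i, b) = (i, a)]. Replace the two coordinates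
    of an element [u] on block [i] by their sum [bsum i u] and their
    difference [bdiff i u]. The sums multiply by a symmetric rule
    ([bsum_qmul], [bsum_qmulC]), and the differences by
    [bdiff_k (uv) = bdiff_k u * bsum_k v
                    + bdiff_i u * bdiff_j v + bdiff_j u * bdiff_i v]
    for [{i, j, k} = Z/3] ([bdiff_qmul]).

    Let [f_i] be the difference of the two basis elements of block [i]
    ([dgen i]), and let [psi] be an automorphism. Since [f_i] is a commutator,
    all block sums of [psi f_i] vanish; since [f_i] squares to zero,
    [psi f_i] has at most one nonzero block difference. So [psi f_i] is a
    multiple of some [f_j] ([aut_dgen_multiple]), and applying the same to the
    inverse of [psi] shows that [psi f_i = +- f_(s i)] for a permutation [s]
    ([aut_dgen]).

    Left multiplication by the [f_i] reads off every coordinate: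
    [f_i v = bsum_i v f_i + sum_(k <> i) bdiff_(-(k + i)) v f_k]
    ([qmul_dgen]). Comparing [psi (f_i v)] with [psi f_i * psi v] shows that
    [psi] carries the block sum at [i] to the block sum at [s i], and the block
    difference likewise up to a sign depending only on [i] ([aut_blocks]).
    Hence [psi] moves block [i] onto block [s i], possibly exchanging its two
    elements, and this exchange is an automorphism of the quandle ring of a
    two-element trivial quandle ([flip_aut]). *)

(** * Blocks indexed by Z/3 *)

(** For distinct blocks [i] and [j] the remaining one is [-(i + j)], because
    the elements of Z/3 add up to zero; for [i = j] the formula returns [i],
    which is why it serves in every case below. *)
Lemma third_eq_self (i j : 'I_3) : (- (i + j) == i) = (j == i).
Proof. by case: i => [[|[|[|i]]] ?]; case: j => [[|[|[|j]]] ?]. Qed.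

Lemma third_diag (i : 'I_3) : - (i + i) = i.
Proof. by apply/eqP; rewrite third_eq_self. Qed.

Lemma third_unique (i j k : 'I_3) :
  i != j -> k != i -> k != j -> - (i + j) = k.
Proof.
move=> ij ki kj; apply/eqP; move: ij ki kj.
by case: i => [[|[|[|i]]] ?]; case: j => [[|[|[|j]]] ?];
   case: k => [[|[|[|k]]] ?].
Qed.

Lemma third_involutive (k j : 'I_3) : - (k + - (k + j)) = j.
Proof. by rewrite [LHS]opprD opprK addKr. Qed.

Lemma loE (i : 'I_3) : lo i = (2 * i)%N :> nat.
Proof. by rewrite /lo pt_val; case: i => [[|[|[|i]]] hi]. Qed.

Lemma hiE (i : 'I_3) : hi i = (2 * i).+1 :> nat.
Proof. by rewrite /hi pt_val; case: i => [[|[|[|i]]] hi]. Qed.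

(** * The quandle law and the product in block coordinates *)

Lemma lo_lo (i j : 'I_3) : op6 (lo i) (lo j) = lo (- (i + j)).
Proof.
apply: val_inj; rewrite /= op6E !loE.
by case: i => [[|[|[|i]]] ?]; case: j => [[|[|[|j]]] ?].
Qed.

Lemma hi_lo (i j : 'I_3) : op6 (hi i) (lo j) = hi (- (i + j)).
Proof.
apply: val_inj; rewrite /= op6E !loE !hiE.
by case: i => [[|[|[|i]]] ?]; case: j => [[|[|[|j]]] ?].
Qed.

Lemma lo_hi (i j : 'I_3) :
  op6 (lo i) (hi j) = if i == j then lo i else hi (- (i + j)).
Proof.
apply: val_inj; rewrite /= op6E !loE !hiE (fun_if val) /= loE hiE.
by case: i => [[|[|[|i]]] ?]; case: j => [[|[|[|j]]] ?].
Qed.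

Lemma hi_hi (i j : 'I_3) :
  op6 (hi i) (hi j) = if i == j then hi i else lo (- (i + j)).
Proof.
apply: val_inj; rewrite /= op6E !hiE (fun_if val) /= loE hiE.
by case: i => [[|[|[|i]]] ?]; case: j => [[|[|[|j]]] ?].
Qed.

Lemma eq_lo (i j : 'I_3) : (lo i == lo j) = (i == j).
Proof. by rewrite -!val_eqE /= !loE; lia. Qed.

Lemma eq_hi (i j : 'I_3) : (hi i == hi j) = (i == j).
Proof. by rewrite -!val_eqE /= !hiE; lia. Qed.

Lemma eq_lo_hi (i j : 'I_3) : (lo i == hi j) = false.
Proof. by rewrite -val_eqE /= loE hiE; lia. Qed.

Lemma eq_hi_lo (i j : 'I_3) : (hi i == lo j) = false.
Proof. by rewrite eq_sym eq_lo_hi. Qed.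

Lemma lo_or_hi (z : X6) : exists i : 'I_3, z = lo i \/ z = hi i.
Proof.
have zlt : (z < 6)%N := ltn_ord z.
have hz : (z %/ 2 < 3)%N by lia.
exists (Ordinal hz); case: (boolP (odd z)) => oz; [right | left];
  apply: val_inj; rewrite /= ?loE ?hiE /=; lia.
Qed.

Lemma sum_blocks (F : X6 -> int) :
  \sum_y F y = \sum_(i < 3) (F (lo i) + F (hi i)).
Proof.
rewrite !big_ord_recr !big_ord0 /= !add0r !addrA.
by congr (_ + _ + _ + _ + _ + _); congr F; apply: val_inj;
   rewrite /= ?loE ?hiE.
Qed.

(** Each right multiplication is an involution, so that the coefficient of a
    product at [z] is a single sum over the right factor, as in [qmulE]. *)
Lemma op6K (z y : 'I_6) : op6 (op6 z y) y = z.
Proof.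
apply: val_inj; rewrite /= !op6E.
by case: z => [[|[|[|[|[|[|z]]]]]] ?] //; case: y => [[|[|[|[|[|[|y]]]]]] ?].
Qed.

Lemma qbasis_sum_coord (X : finQuandle) (I : finType) (P : pred I)
    (g : I -> X) (c : I -> int) (z : X) :
  (\sum_(i | P i) qbasis (g i) *~ c i) z = \sum_(i | P i && (z == g i)) c i.
Proof.
rewrite sum_ffunE big_mkcondr /=; apply: eq_bigr => i _.
by rewrite ffunMzE ffunE; case: eqP => _; rewrite ?mul0rz // intz.
Qed.

Lemma qmulE (u v : qring X6) (z : X6) :
  qmul u v z = \sum_y u (op6 z y) * v y.
Proof.
rewrite /qmul exchange_big sum_ffunE; apply: eq_bigr => y _.
rewrite qbasis_sum_coord; apply: big_pred1 => x /=.
by apply/eqP/eqP => ->; rewrite op6K.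
Qed.

Definition bsum (i : 'I_3) (u : qring X6) : int := u (lo i) + u (hi i).
Definition bdiff (i : 'I_3) (u : qring X6) : int := u (lo i) - u (hi i).

Fact bsum_additive i : zmod_morphism (bsum i).
Proof. by move=> u v; rewrite /bsum !ffunE; ring. Qed.

Fact bdiff_additive i : zmod_morphism (bdiff i).
Proof. by move=> u v; rewrite /bdiff !ffunE; ring. Qed.

HB.instance Definition _ i :=
  GRing.isZmodMorphism.Build (qring X6) int (bsum i) (bsum_additive i).
HB.instance Definition _ i :=
  GRing.isZmodMorphism.Build (qring X6) int (bdiff i) (bdiff_additive i).

(** The two coordinates are half the sum and half the difference of the sum and
    the difference; the ring of integers has no 2-torsion. *)
Lemma bsum_bdiff_inj (u v : qring X6) :
  (forall i, bsum i u = bsum i v) -> (forall i, bdiff i u = bdiff i v) -> u = v.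
Proof.
move=> hs hd; apply/ffunP => z; case: (lo_or_hi z) => i zE.
move: (hs i) (hd i); rewrite /bsum /bdiff => h1 h2.
case: zE => ->; lia.
Qed.

Lemma bsum_qmul k (u v : qring X6) :
  bsum k (qmul u v) = \sum_j bsum (- (k + j)) u * bsum j v.
Proof.
rewrite {1}/bsum !qmulE !sum_blocks -big_split /=; apply: eq_bigr => j _.
rewrite lo_lo hi_lo lo_hi hi_hi /bsum; case: eqP => [<-|_]; last by ring.
by rewrite third_diag; ring.
Qed.

Lemma bdiff_qmul k (u v : qring X6) :
  bdiff k (qmul u v) =
  \sum_j (if j == k then bdiff k u * bsum k v
          else bdiff (- (k + j)) u * bdiff j v).
Proof.
rewrite {1}/bdiff !qmulE !sum_blocks -sumrB; apply: eq_bigr => j _.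
rewrite lo_lo hi_lo lo_hi hi_hi [k == j]eq_sym /bdiff /bsum.
case: eqP => [->|_]; last by ring.
by rewrite third_diag; ring.
Qed.

Lemma bdiff_qmul_third i j k (u v : qring X6) :
  i != j -> k != i -> k != j ->
  bdiff k (qmul u v) =
  bdiff k u * bsum k v + (bdiff i u * bdiff j v + bdiff j u * bdiff i v).
Proof.
move=> ij ki kj; have [ji ik jk] : [/\ j != i, i != k & j != k].
  by rewrite eq_sym ij eq_sym ki eq_sym kj.
rewrite bdiff_qmul (bigD1 k) //= eqxx (bigD1 j) //= (negPf jk).
rewrite (bigD1 i) /= ?ik // (negPf ik) big1 ?addr0.
  by rewrite (third_unique kj ik ij) (third_unique ki jk ji).
move=> m /andP[/andP[mk mj] /negP[]].
by rewrite -(third_unique kj ik ij) (third_unique kj mk mj).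
Qed.

(** The involution [j |-> -(k + j)] exchanges the two factors in [bsum_qmul]:
    the block sums form the ring of the commutative quandle Z/3 with product
    [-(i + j)], so that commutators have vanishing block sums. *)
Lemma bsum_qmulC k (u v : qring X6) :
  bsum k (qmul u v) = bsum k (qmul v u).
Proof.
rewrite !bsum_qmul (reindex_inj (h := fun j => - (k + j))) => [|i j]; last first.
  by move/oppr_inj/addrI.
by apply: eq_bigr => j _ /=; rewrite mulrC third_involutive.
Qed.

(** * Differences within a block *)

Definition dgen (i : 'I_3) : qring X6 := qbasis (lo i) - qbasis (hi i).

Lemma bsum_dgen k i : bsum k (dgen i) = 0.
Proof.
by rewrite /bsum !ffunE eq_lo eq_hi eq_lo_hi eq_hi_lo; case: eqP.
Qed.

Lemma bdiff_dgen k i : bdiff k (dgen i) = if k == i then 2 else 0.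
Proof.
by rewrite /bdiff !ffunE eq_lo eq_hi eq_lo_hi eq_hi_lo; case: eqP.
Qed.

Lemma dgen_commutator i :
  dgen i = qmul (qbasis (lo i)) (qbasis (hi i))
         - qmul (qbasis (hi i)) (qbasis (lo i)).
Proof.
rewrite !qmul_basis /= lo_hi hi_lo eqxx; by rewrite third_diag.
Qed.

Lemma bdiff_sum_dgen (s : 'I_3 -> 'I_3) (a : 'I_3 -> int) m : injective s ->
  bdiff (s m) (\sum_k dgen (s k) *~ a k) = 2 * a m.
Proof.
move=> s_inj; rewrite raddf_sum /= (bigD1 m) //= raddfMz /= bdiff_dgen eqxx.
rewrite mulrzz big1 ?addr0 // => k km.
by rewrite raddfMz /= bdiff_dgen inj_eq // eq_sym (negPf km) mul0rz.
Qed.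

(** The block sums of [dgen i] vanish and its only nonzero block difference is
    at [i], so all but one term of [bdiff_qmul] drops out in each block. *)
Lemma qmul_dgen i (v : qring X6) :
  qmul (dgen i) v =
  \sum_k dgen k *~ (if k == i then bsum i v else bdiff (- (k + i)) v).
Proof.
apply: bsum_bdiff_inj => m; last rewrite (bdiff_sum_dgen (s := id)) //.
  rewrite [RHS]raddf_sum /= bsum_qmul !big1 // => j _.
    by rewrite raddfMz /= bsum_dgen mul0rz.
  by rewrite bsum_dgen mul0r.
rewrite bdiff_qmul (bigD1 m) //= eqxx bdiff_dgen.
case: (eqVneq m i) => [->|mi].
  rewrite big1 ?addr0 // => j /negPf ji.
  by rewrite ji bdiff_dgen third_eq_self ji mul0r.
have mm : - (m + i) != m by rewrite third_eq_self eq_sym.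
rewrite mul0r add0r (bigD1 (- (m + i))) //= (negPf mm) third_involutive.
rewrite bdiff_dgen eqxx big1 ?addr0 // => j /andP[jm ji].
rewrite (negPf jm) bdiff_dgen; case: eqP => [e|]; last by rewrite mul0r.
by case/negP: ji; rewrite -e third_involutive.
Qed.

Lemma qmulMz (u v : qring X6) (c : int) : qmul (u *~ c) v = qmul u v *~ c.
Proof.
apply/ffunP => z; rewrite ffunMzE !qmulE mulrz_suml.
by apply: eq_bigr => y _; rewrite ffunMzE mulrzAl.
Qed.

(** * Automorphisms permute the blocks *)

Lemma aut_additive (X : finQuandle) (f : qring X -> qring X) : qring_aut f ->
  exists g : {additive qring X -> qring X}, f = g.
Proof.
move=> [_ fD _]; have fB : zmod_morphism f.
  by move=> u v; apply/eqP; rewrite eq_sym subr_eq -fD subrK.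
by exists (HB.pack_for {additive qring X -> qring X} f
    (GRing.isZmodMorphism.Build _ _ f fB)).
Qed.

Lemma aut_inv (X : finQuandle) (f : qring X -> qring X) : qring_aut f ->
  exists2 g, cancel f g & qring_aut g.
Proof.
move=> [[g fK gK] fD fM]; exists g => //; split; first by exists f.
  by move=> u v; apply: (can_inj fK); rewrite fD !gK.
by move=> u v; apply: (can_inj fK); rewrite fM !gK.
Qed.

(** Being a commutator forces the block sums of [psi (dgen i)] to vanish. Being
    of square zero forces its block differences to have zero pairwise products,
    because the third block difference of the square is twice such a product. *)
Lemma aut_dgen_multiple psi : @qring_aut X6 psi ->
  forall i, exists j (c : int), psi (dgen i) = dgen j *~ c.
Proof.
move=> hpsi i; have [_ _ psiM] := hpsi.
have [g gE] := aut_additive hpsi; rewrite {}gE {psi hpsi} in psiM *.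
set x := g _.
have sx k : bsum k x = 0.
  by rewrite /x dgen_commutator raddfB /= !psiM raddfB /= bsum_qmulC subrr.
have xx : qmul x x = 0.
  rewrite -psiM qmul_dgen big1; first exact: raddf0.
  move=> k _; case: eqP => [->|/eqP ki]; first by rewrite bsum_dgen mulr0z.
  by rewrite bdiff_dgen addrC third_eq_self (negPf ki) mulr0z.
have dx j k : j != k -> bdiff j x * bdiff k x = 0.
  move=> jk; have [nj nk] : - (j + k) != j /\ - (j + k) != k.
    by rewrite third_eq_self [j + k]addrC third_eq_self eq_sym.
  have := bdiff_qmul_third x x jk nj nk.
  rewrite xx raddf0 /= sx mulr0 add0r [bdiff k x * _]mulrC; lia.
have [j dk] : exists j, forall k, k != j -> bdiff k x = 0.
  case: (pickP (fun j => bdiff j x != 0)) => [j xj|x0]; last first.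
    by exists 0 => k _; apply/eqP; rewrite -[_ == _]negbK x0.
  by exists j => k /dx/eqP; rewrite mulf_eq0 (negPf xj) orbF => /eqP.
(* The sum on block [j] vanishes, so the coefficient of [lo j] is the factor. *)
exists j, (x (lo j)); apply: bsum_bdiff_inj => k; rewrite raddfMz /=.
  by rewrite bsum_dgen mul0rz.
rewrite bdiff_dgen; case: eqP => [->|/eqP /dk ->]; last by rewrite mul0rz.
move: (sx j); rewrite /bsum /bdiff mulrzz => /eqP; rewrite addr_eq0 => /eqP ->; ring.
Qed.

(** The inverse automorphism also sends each [dgen j] to a multiple of some
    [dgen k]; composing the two makes the index map injective and the integer
    factors invertible. *)
Lemma aut_dgen psi : @qring_aut X6 psi ->
  exists (s : 'S_3) (c : 'I_3 -> bool),
    forall i, psi (dgen i) = dgen (s i) *~ (-1) ^+ c i.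
Proof.
move=> hpsi; have [chi psiK hchi] := aut_inv hpsi.
have /fin_all_exists[s /fin_all_exists[c psiE]] := aut_dgen_multiple hpsi.
have inv i : exists2 t, chi (dgen (s i)) = dgen i *~ t & t * c i = 1.
  have [j [t tE]] := aut_dgen_multiple hchi (s i).
  have [g gE] := aut_additive hchi.
  have dE : dgen j *~ t *~ c i = dgen i.
    by rewrite -[RHS]psiK psiE -tE gE raddfMz.
  move: (congr1 (bdiff i) dE); rewrite !raddfMz /= !bdiff_dgen eqxx.
  case: eqP tE => [<-|_] tE; last by rewrite !mul0rz.
  by rewrite !mulrzz => tc; exists t => //; lia.
have s_inj : injective s.
  move=> i j sij; have [t ti tc] := inv i; have [t' tj _] := inv j.
  have : dgen i *~ t = dgen j *~ t' by rewrite -ti -tj sij.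
  move/(congr1 (bdiff i)); rewrite !raddfMz /= !bdiff_dgen eqxx.
  by case: eqP => // _; rewrite mul0rz mulrzz; nia.
exists (perm s_inj), (fun i => c i == -1) => i.
rewrite psiE permE; congr (_ *~ _).
have [t _ tc] := inv i.
have /eqP := congr1 absz tc; rewrite abszM muln_eq1 => /andP[_ /eqP ci1].
by have [->|->] : c i = 1 \/ c i = -1 by lia.
Qed.

(** In [psi (dgen i * u) = psi (dgen i) * psi u] the block difference at
    [s i] gives the block sums of [psi u]. The block difference at [s m] with
    [m <> i] gives its block difference at [s] of the third index, up to the
    product of the signs of [i] and [m]. *)
Lemma aut_blocks psi : @qring_aut X6 psi ->
  exists (s : 'S_3) (c : 'I_3 -> bool), forall i u,
    bsum (s i) (psi u) = bsum i u /\
    bdiff (s i) (psi u) = (-1) ^+ c i * bdiff i u.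
Proof.
move=> hpsi; have [s [c psiE]] := aut_dgen hpsi.
have [_ _ psiM] := hpsi.
have [g gE] := aut_additive hpsi; rewrite {}gE {psi hpsi} in psiE psiM *.
have key i m u :
    (if m == i then bsum (s i) (g u) else bdiff (- (s m + s i)) (g u))
      * (-1) ^+ c i =
    (if m == i then bsum i u else bdiff (- (m + i)) u) * (-1) ^+ c m.
  have := congr1 (bdiff (s m)) (psiM (dgen i) u).
  rewrite psiE qmulMz !qmul_dgen raddfMz /= (bdiff_sum_dgen (s := id)) //.
  rewrite (inj_eq perm_inj) raddf_sum /=.
  under eq_bigr do rewrite raddfMz /= psiE -mulrzA.
  rewrite (bdiff_sum_dgen (s := s)); last exact: perm_inj.
  rewrite mulrzz => e; rewrite [RHS]mulrC.
  by apply: (mulfI (x := 2)) => //; rewrite e mulrA.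
(* Block [i] is the third one for the pair [i + 1], [i + 2], so its sign is the
   product of theirs. *)
exists s, (fun i => c (i + 1) (+) c (i + 2)) => i u; split.
  by have := key i i u; rewrite eqxx; case: (c i); rewrite /= ?expr0 ?expr1; lia.
have [i1 i2 i12] : [/\ i != i + 1, i != i + 2 & i + 2 != i + 1].
  by case: i => [[|[|[|i]]] ?].
have := key (i + 1) (i + 2) u; rewrite (negPf i12).
rewrite (@third_unique (s (i + 2)) (s (i + 1)) (s i)) ?(inj_eq perm_inj) //.
rewrite (@third_unique (i + 2) (i + 1) i) //.
by case: (c _); case: (c _); rewrite /= ?expr0 ?expr1; lia.
Qed.

(** * Exchanging the two elements of a trivial quandle *)

Lemma qmul_trivial (X : finQuandle) (u v : qring X) (z : X) :
  trivial_quandle X -> qmul u v z = u z * \sum_y v y.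
Proof.
move=> triv; rewrite /qmul exchange_big sum_ffunE mulr_sumr.
apply: eq_bigr => y _; rewrite qbasis_sum_coord.
by apply: big_pred1 => x; rewrite triv eq_sym.
Qed.

(** On a two-element set this exchanges the two coefficients; the formula spares
    naming the other element. *)
Definition flip (X : finQuandle) (u : qring X) : qring X :=
  [ffun a => \sum_b u b - u a].

Lemma sum_flip (X : finQuandle) (u : qring X) : #|X| = 2 ->
  \sum_a flip u a = \sum_a u a.
Proof.
move=> X2; rewrite (eq_bigr _ (fun a _ => ffunE _ a)) sumrB sumr_const X2.
by rewrite mulr2n addrK.
Qed.

(** The product of [Z[X]] is [u v = eps(v) u] for the sum of coefficients
    [eps], so that any additive bijection preserving [eps] is an automorphism.
    Two elements are needed for [eps (flip u) = eps u]. *)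
Lemma flip_aut (X : finQuandle) :
  trivial_quandle X -> #|X| = 2 -> qring_aut (@flip X).
Proof.
move=> triv X2; split.
- by exists (@flip X) => u; apply/ffunP => a;
    rewrite ffunE sum_flip // ffunE subKr.
- move=> u v; apply/ffunP => a; rewrite !ffunE.
  under eq_bigr do rewrite ffunE.
  by rewrite big_split /= addrACA opprD.
- move=> u v; apply/ffunP => a; rewrite qmul_trivial // sum_flip // !ffunE.
  under eq_bigr do rewrite qmul_trivial //.
  by rewrite qmul_trivial // -mulr_suml mulrBl.
Qed.

Lemma id_aut (X : finQuandle) : @qring_aut X id.
Proof. by split=> //; exists id. Qed.

(** * Coordinates of the extended and permuting maps *)

Section ExtCoord.
Variables (X : finQuandle) (A : {set X}) (hA : subquandle_closed A).
Variable f : qring (subQuandle hA) -> qring (subQuandle hA).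
Implicit Types (u : qring X) (z : X).

Lemma qring_ext_in u (a : subQuandle hA) :
  qring_ext f u (sval a) = f (qring_proj hA u) a.
Proof.
rewrite /qring_ext /qring_incl ffunE !qbasis_sum_coord.
rewrite (big_pred1 a) => [|b]; last by rewrite /= eq_sym.
rewrite big1 ?addr0 // => x /andP[xA /eqP e].
by case/negP: xA; rewrite -e; exact: (valP a).
Qed.

Lemma qring_ext_out u z : z \notin A -> qring_ext f u z = u z.
Proof.
move=> zA; rewrite /qring_ext /qring_incl ffunE !qbasis_sum_coord.
rewrite big1 ?add0r => [|a /eqP e]; last first.
  by case/negP: zA; rewrite e; exact: (valP a).
apply: big_pred1 => x; rewrite /= [z == x]eq_sym.
by case: eqP => [->|]; rewrite ?zA ?andbF.
Qed.

End ExtCoord.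

Definition swap_if (c : 'I_3 -> bool) (i : 'I_3) :
  qring (X6_ i) -> qring (X6_ i) :=
  if c i then @flip (X6_ i) else id.

Lemma swap_if_aut c i : qring_aut (@swap_if c i).
Proof.
rewrite /swap_if; case: (c i); last exact: id_aut.
apply: flip_aut (@X6_trivial i) _.
by rewrite card_sig; apply: etrans (cards2 (lo i) (hi i)) _; rewrite eq_lo_hi.
Qed.

Lemma lo_block j i : (lo j \in block i) = (j == i).
Proof. by rewrite !inE eq_lo eq_lo_hi orbF. Qed.

Lemma hi_block j i : (hi j \in block i) = (j == i).
Proof. by rewrite !inE eq_hi eq_hi_lo. Qed.

Lemma swap_if_ext c i u (a : X6_ i) :
  qring_ext (@swap_if c i) u (sval a) =
  if c i then bsum i u - u (sval a) else u (sval a).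
Proof.
rewrite qring_ext_in /swap_if; case: (c i); rewrite !ffunE //.
congr (_ - _); under eq_bigr do rewrite ffunE.
rewrite -(big_sub (block i) u) /= big_setU1 ?big_set1 //.
by rewrite inE eq_lo_hi.
Qed.

Lemma swap_if_lo c i u j :
  qring_ext (@swap_if c i) u (lo j) =
  if (j == i) && c i then u (hi j) else u (lo j).
Proof.
case: eqP => [->|/eqP ji]; last by rewrite qring_ext_out // lo_block.
have li : lo i \in block i by rewrite lo_block.
rewrite (swap_if_ext c u (exist _ (lo i) li)) /bsum /=.
by case: (c i) => //; ring.
Qed.

Lemma swap_if_hi c i u j :
  qring_ext (@swap_if c i) u (hi j) =
  if (j == i) && c i then u (lo j) else u (hi j).
Proof.
case: eqP => [->|/eqP ji]; last by rewrite qring_ext_out // hi_block.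
have li : hi i \in block i by rewrite hi_block.
rewrite (swap_if_ext c u (exist _ (hi i) li)) /bsum /=.
by case: (c i) => //; ring.
Qed.

Lemma block_perm_lo s u i : block_perm s u (lo (s i)) = u (lo i).
Proof.
rewrite /block_perm sum_ffunE (bigD1 i) //= big1 => [|j ji];
  rewrite !ffunE !ffunMzE !ffunE eq_lo eq_lo_hi ?eqxx mul0rz addr0.
  by rewrite addr0 intz.
by rewrite (inj_eq perm_inj) eq_sym (negPf ji) mul0rz.
Qed.

Lemma block_perm_hi s u i : block_perm s u (hi (s i)) = u (hi i).
Proof.
rewrite /block_perm sum_ffunE (bigD1 i) //= big1 => [|j ji];
  rewrite !ffunE !ffunMzE !ffunE eq_hi eq_hi_lo ?eqxx mul0rz add0r.
  by rewrite addr0 intz.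
by rewrite (inj_eq perm_inj) eq_sym (negPf ji) mul0rz.
Qed.

Theorem proposition6p4 (psi : qring X6 -> qring X6) (hpsi : @qring_aut X6 psi) :
  exists (phi : forall i : 'I_3, qring (X6_ i) -> qring (X6_ i)) (s : 'S_3),
    (forall i : 'I_3, @qring_aut (X6_ i) (phi i)) /\
    (forall u : qring X6,
       psi u = qring_ext (phi 0) (qring_ext (phi 1) (qring_ext (phi 2)
                 (block_perm s u)))).
Proof.
have [s [c psiE]] := aut_blocks hpsi.
(* The sign is indexed by the source block, the factor [phi] by its image. *)
pose c' i := c ((s^-1)%g i).
exists (@swap_if c'), s; split=> [i|u]; first exact: swap_if_aut.
pose nest v := qring_ext (@swap_if c' 0)
  (qring_ext (@swap_if c' 1) (qring_ext (@swap_if c' 2) v)).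
have j012 (j : 'I_3) : [|| j == 0, j == 1 | j == 2].
  by case: j => [[|[|[|j]]] ?].
have nest_lo v j : nest v (lo j) = if c' j then v (hi j) else v (lo j).
  rewrite /nest !(swap_if_lo, swap_if_hi).
  by case/or3P: (j012 j) => /eqP->; case: (c' _).
have nest_hi v j : nest v (hi j) = if c' j then v (lo j) else v (hi j).
  rewrite /nest !(swap_if_lo, swap_if_hi).
  by case/or3P: (j012 j) => /eqP->; case: (c' _).
rewrite -/(nest _).
apply: bsum_bdiff_inj => j; rewrite -[j](permKV s); set i := (s^-1)%g j;
  have [si di] := psiE i u; rewrite ?si ?di /bsum /bdiff nest_lo nest_hi;
  rewrite block_perm_lo block_perm_hi /c' permK;
  by case: (c i); rewrite ?expr0 ?expr1; ring.
Qed.
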